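(* For any real number $[f]\in\mathcal{S}_{\mathbb{R}}$ there exists a real number $[g]\in\mathcal{S}_{\mathbb{R}}$ such that $[f]+[g]=[0]$.
   Context: Conventions. $\omega=\{0,1,2,\dots\}$, $\omega_+=\omega\setminus\{0\}$, $[a,b]_\omega=\{n\in\omega:a\le n\le b\}$, $[a,\infty]_\omega=\{n\in\omega:n\ge a\}$. A system function $\vartheta:\omega_+\to[2,\infty]_\omega$ is fixed. Contractions. For $f:\omega\to\omega$ and $n\in\omega_+$, the contraction $c_n$ is applicable to $f$ iff $f(n+1)\ge\vartheta(n)$, and then $c_n(f)(n)=f(n)+1$, $c_n(f)(n+1)=f(n+1)-\vartheta(n)$, $c_n(f)(k)=f(k)$ for other $k$. A sequence of contractions is a finite (possibly empty) composition of contractions; it is applicable to $f$ iff each contraction in turn is applicable to the result of the preceding ones. Sign. For $f:\omega\to\omega$, $\sigma(f)=0$ if $f(0)$ is odd and $\sigma(f)=1$ if $f(0)$ is even. Auxiliary functions. $h:\omega\to\omega$ is a primary auxiliary function ($h\in A_p$) if $h(k)<\vartheta(k-1)$ for all $k\ge2$ and for every $N\in\omega_+$ there is $M\ge N+1$ with $h(M)\ne\vartheta(M-1)-1$. It is a secondary auxiliary function ($h\in A_s$) if $h(k)<\vartheta(k-1)$ for all $k\ge2$ and there is $N\in\omega_+$ with $h(M)=\vartheta(M-1)-1$ for all $M\ge N+1$; the least such $N$ is $N^h_{\min}$. Base set. $W_1$ is the set of pairs $(h_p,h_s)\in A_p\times A_s$ such that, with $N=N^{h_s}_{\min}$, $h_p(k)=h_s(k)$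 for $k<N$, $h_p(N)=h_s(N)+1$, and $h_p(k)=0$ for $k>N$. Two pairs in $W_1$ are equivalent if their first components agree on $\omega_+$ and have the same sign; $F$ is the collection of sets obtained by taking, for each equivalence class, the set of all functions that are components of its pairs. $W_2$ is the set of primary auxiliary functions occurring in no pair of $W_1$; two elements of $W_2$ are equivalent if they agree on $\omega_+$ and have the same sign; $G_2$ is the set of equivalence classes. The base set is $B=F\cup G_2$. Real numbers. For $b\in B$, $r_b$ is the set of $f:\omega\to\omega$ for which there is $h\in b$ such that for every $N\in\omega_+$ some sequence of contractions $\mathcal{C}$ applicable to $f$ satisfies $\mathcal{C}(f)(n)=h(n)$ for all $n\in[0,N]_\omega$. Let $b_1,b_2\in B$ be the elements containing respectively the zero function, and the function with value $1$ at $0$ and $0$ elsewhere. $\mathcal{S}_{\mathbb{R}}$ (the set of real numbers) consists of all $r_b$ with $b\in B\setminus\{b_1,b_2\}$ together with $[0]:=r_{b_1}\cup r_{b_2}$. Put $\mathcal{S}_{\mathbb{R}}^*=\mathcal{S}_{\mathbb{R}}\setminus\{[0]\}$. Distinct real numbers are disjoint. A function lying in some real number is called finite, and $[f]$ denotes the real number containing $f$. For $[a]\in\mathcal{S}_{\mathbb{R}}^*$ all elements have the same sign, denoted $\sigma([a])$. Every real number $[x]$ contains primary auxiliary functions, and they all agree on $\omega_+$; $x_p$ denotes one of them. Order. For $[a],[b]\in\mathcal{S}_{\mathbb{R}}^*$, $[a]\le[b]$ iff one of the following holds: (i) $\sigma([a])<\sigma([b])$; (ii) $\sigma([a])=\sigma([b])=1$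 and for every $a\in[a]$ there is $b\in[b]$ with $a(n)\le b(n)$ for all $n\in\omega_+$; (iii) $\sigma([a])=\sigma([b])=0$ and for every $b\in[b]$ there is $a\in[a]$ with $a(n)\ge b(n)$ for all $n\in\omega_+$. For $[a]\in\mathcal{S}_{\mathbb{R}}^*$, $[a]\le[0]$ iff $\sigma([a])=0$, and $[0]\le[a]$ iff $\sigma([a])=1$. Finally $[0]\le[0]$ holds. Strict order: $[a]<[b]$ iff not $[b]\le[a]$. Addition. The absolute value $|f|$ of $f:\omega\to\omega$ is the function with $|f|(0)=0$ and $|f|(k)=f(k)$ for $k\in\omega_+$; for a real number, $|[x]|:=[|f|]$ for any $f\in[x]$ (independent of $f$). For finite $f,g$ with $|[f]|>|[g]|$, the set of tracking functions $\mathcal{T}^f_g$ consists of all $\varrho:\omega\to\omega$ for which there is $w\in[f]$ with $w(n)\ge g(n)$ for all $n\in\omega_+$, $\varrho(0)=w(0)$ and $\varrho(n)=w(n)-g(n)$ for all $n\in\omega_+$. If moreover $\sigma(f)\ne\sigma(g)$ or $g\in[0]$, then $\mathcal{T}^f_g$ is non-empty and contained in a single real number $[x]$, and the primary tracking function $\varrho^f_g$ is defined by $\varrho^f_g(0)=f(0)$, $\varrho^f_g(k)=x_p(k)$ for $k\in\omega_+$. For finite $f,g$ the sub-sum $f+g:\omega\to\omega$ is: if $\sigma(f)=\sigma(g)$ and $f,g\notin[0]$, then $(f+g)(0)=f(0)g(0)$ and $(f+g)(k)=f(k)+g(k)$ for $k\in\omega_+$; otherwise $f+g$ is the zero function if $|[f]|=|[g]|$,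 is $\varrho^f_g$ if $|[f]|>|[g]|$, and is $\varrho^g_f$ if $|[f]|<|[g]|$. Addition of real numbers: $[f]+[g]:=[f+g]$ for any $f\in[f]$, $g\in[g]$ (independent of the choice of representatives). *)

(* Defs.v *)
From mathcomp Require Import all_boot.
From mathcomp Require Import boolp classical_sets.

Set Implicit Arguments.
Unset Strict Implicit.
Unset Printing Implicit Defensive.

Local Open Scope classical_set_scope.
Local Open Scope nat_scope.

(* [get P] (classical_sets) is the description operator "the x such that P x";
   when no such x exists it returns a default value, which is the empty set at
   type [set T]. No real number is empty. *)

(* A system function has domain omega_+; it is encoded as a function on nat
   whose value at 0 is irrelevant: no definition below ever reads it. *)
Definition system_function (theta : nat -> nat) : Prop :=
  forall n, 0 < n -> 2 <= theta n.

Section RealNumbers.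

Variable theta : nat -> nat.

Implicit Types f g h : nat -> nat.

Definition eq_pos f g : Prop := forall k, 0 < k -> f k = g k.

Definition applicable (n : nat) f : Prop := 0 < n /\ theta n <= f n.+1.

Definition contraction (n : nat) f : nat -> nat := fun k =>
  if k == n then f n + 1
  else if k == n.+1 then f n.+1 - theta n
  else f k.

(* A sequence of contractions is the list of its indices, the head being the
   contraction that is performed first. *)
Fixpoint contract (s : seq nat) f : nat -> nat :=
  if s is n :: s' then contract s' (contraction n f) else f.

Fixpoint seq_applicable (s : seq nat) f : Prop :=
  if s is n :: s' then applicable n f /\ seq_applicable s' (contraction n f)
  else True.

Definition sign f : nat := if odd (f 0) then 0 else 1.

Definition A_p : set (nat -> nat) := [set h |
  (forall k, 2 <= k -> h k < theta (k - 1)) /\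
  (forall N, 0 < N -> exists2 M, N + 1 <= M & h M <> theta (M - 1) - 1)].

Definition full_after h (N : nat) : Prop :=
  forall M, N + 1 <= M -> h M = theta (M - 1) - 1.

Definition A_s : set (nat -> nat) := [set h |
  (forall k, 2 <= k -> h k < theta (k - 1)) /\
  (exists2 N, 0 < N & full_after h N)].

Definition is_Nmin h (N : nat) : Prop :=
  [/\ 0 < N, full_after h N & forall N', 0 < N' -> full_after h N' -> N <= N'].

Definition W1 : set ((nat -> nat) * (nat -> nat)) := [set p |
  [/\ A_p p.1, A_s p.2 &
    exists2 N, is_Nmin p.2 N &
      [/\ forall k, k < N -> p.1 k = p.2 k,
          p.1 N = p.2 N + 1 &
          forall k, N < k -> p.1 k = 0]]].

Definition same_pos_sign f g : Prop := eq_pos f g /\ sign f = sign g.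

Definition classes (T : Type) (W : set T) (E : T -> T -> Prop) : set (set T) :=
  [set C | exists2 x, W x & C = [set y | W y /\ E x y]].

Definition components (C : set ((nat -> nat) * (nat -> nat))) :
    set (nat -> nat) :=
  [set h | exists2 p, C p & h = p.1 \/ h = p.2].

Definition base_F : set (set (nat -> nat)) :=
  components @` classes W1 (fun p q => same_pos_sign p.1 q.1).

Definition W2 : set (nat -> nat) := A_p `\` components W1.

Definition base_G2 : set (set (nat -> nat)) := classes W2 same_pos_sign.

Definition base : set (set (nat -> nat)) := base_F `|` base_G2.

Definition r_ (b : set (nat -> nat)) : set (nat -> nat) := [set f |
  exists2 h, b h &
    forall N, 0 < N ->
      exists2 s, seq_applicable s f &
        forall n, n <= N -> contract s f n = h n].

Definition zero_fun : nat -> nat := fun=> 0.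
Definition neg_zero_fun : nat -> nat := fun k => if k == 0 then 1 else 0.

Definition base_of h : set (nat -> nat) := get [set b | base b /\ b h].

Definition b1 := base_of zero_fun.
Definition b2 := base_of neg_zero_fun.

Definition rzero : set (nat -> nat) := r_ b1 `|` r_ b2.

Definition reals : set (set (nat -> nat)) :=
  r_ @` (base `\` [set b1; b2]) `|` [set rzero].

Implicit Types X Y Z : set (nat -> nat).

(* the real number [f] containing f *)
Definition class_of f : set (nat -> nat) := get [set X | reals X /\ X f].

(* common sign of the elements of X *)
Definition rsign X : nat := get [set e | forall f, X f -> sign f = e].

Definition rle X Y : Prop :=
  [\/ [/\ X <> rzero, Y <> rzero &
        [\/ rsign X < rsign Y,
            [/\ rsign X = 1, rsign Y = 1 &
              forall f, X f ->
                exists2 g, Y g & forall n, 0 < n -> f n <= g n] |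
            [/\ rsign X = 0, rsign Y = 0 &
              forall g, Y g ->
                exists2 f, X f & forall n, 0 < n -> g n <= f n]]],
      [/\ X <> rzero, Y = rzero & rsign X = 0],
      [/\ X = rzero, Y <> rzero & rsign Y = 1] |
      X = rzero /\ Y = rzero].

Definition rlt X Y : Prop := ~ rle Y X.

Definition absf f : nat -> nat := fun k => if k == 0 then 0 else f k.

(* |[x]| := [|f|] for any f in [x]: the real number that contains |f| for all
   representatives f. *)
Definition rabs X : set (nat -> nat) :=
  get [set Z | reals Z /\ forall f, X f -> Z (absf f)].

Definition tracking f g : set (nat -> nat) := [set rho |
  exists w, [/\ class_of f w,
    forall n, 0 < n -> g n <= w n,
    rho 0 = w 0 &
    forall n, 0 < n -> rho n = w n - g n]].

(* x_p: some primary auxiliary function in X (unique on omega_+) *)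
Definition primary X : nat -> nat := get (X `&` A_p).

Definition primary_tracking f g : nat -> nat := fun k =>
  if k == 0 then f 0
  else primary (get [set X | reals X /\ tracking f g `<=` X]) k.

(* Meant for finite f and g, that is, elements of real numbers. *)
Definition subsum f g : nat -> nat :=
  if `[< [/\ sign f = sign g, ~ rzero f & ~ rzero g] >] then
    fun k => if k == 0 then f 0 * g 0 else f k + g k
  else if `[< rabs (class_of f) = rabs (class_of g) >] then zero_fun
  else if `[< rlt (rabs (class_of g)) (rabs (class_of f)) >] then
    primary_tracking f g
  else primary_tracking g f.

(* [f] + [g] := [f + g] for any representatives: the real number that contains
   the sub-sums of all pairs of representatives. *)
Definition radd X Y : set (nat -> nat) :=
  get [set Z | reals Z /\ forall f g, X f -> Y g -> Z (subsum f g)].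

End RealNumbers.

(* Main.v *)
Require Import Defs.
From mathcomp Require Import all_boot.
From mathcomp Require Import boolp classical_sets.
From mathcomp Require Import zify.

(** The negative of a real number is obtained by changing the parity of the
    value at 0, which commutes with contractions and leaves |f| unchanged; hence
    the sub-sum of a representative of [F] and one of its negative falls in the
    case |[f]| = |[g]|, where it is the zero function.  What remains is that
    distinct real numbers are disjoint.  For this, read the digits 1 .. N of [f]
    in the mixed radix system given by [theta] as an integer P_N(f).  Contracting
    at N adds 1 to P_N, any other contraction preserves it.  If [f] contracts to
    the reduced sequence [h] on every initial segment, then P_N(C(f)) <= P_N(h)
    for every applicable sequence C, so two such limits [h], [h'] satisfy
    P_N(h) = P_N(h') for all N and coincide. *)

Set Implicit Arguments.
Unset Strict Implicit.
Unset Printing Implicit Defensive.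

Local Open Scope classical_set_scope.
Local Open Scope nat_scope.

(** * Changing the parity of the value at 0 *)

Definition flip0 (f : nat -> nat) : nat -> nat := fun k =>
  if k == 0 then if odd (f 0) then (f 0).-1 else (f 0).+1 else f k.

(** At 0 the numbers 2m and 2m+1 are swapped. Thanks to this, the preimage of a set under [flip0]
    can serve as its image. *)
Lemma flip0K : involutive flip0.
Proof.
move=> f; apply/funext => -[|k] //; rewrite /flip0 /=.
by case: (f 0) => [|m] //=; case om: (odd m); rewrite /= om.
Qed.

Lemma flip0_pos f k : 0 < k -> flip0 f k = f k.
Proof. by case: k. Qed.

Lemma sign_flip0 f : sign (flip0 f) = 1 - sign f.
Proof. by rewrite /sign /flip0 /=; case: (f 0) => [|m] //=; case om: (odd m); rewrite /= om. Qed.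

Lemma sign_flip0_neq f : sign (flip0 f) <> sign f.
Proof. by rewrite sign_flip0 /sign; case: (odd _). Qed.

Lemma same_pos_sign_flip0 f g :
  same_pos_sign (flip0 f) (flip0 g) <-> same_pos_sign f g.
Proof.
have aux f' g' : same_pos_sign f' g' -> same_pos_sign (flip0 f') (flip0 g').
  move=> [e es]; split; last by rewrite !sign_flip0 es.
  by move=> k k0; rewrite !flip0_pos // e.
by split=> /aux //; rewrite !flip0K.
Qed.

Lemma same_pos_sign_sym f g : same_pos_sign f g -> same_pos_sign g f.
Proof. by move=> [e s]; split=> // k /e. Qed.

Lemma same_pos_sign_trans f g h :
  same_pos_sign f g -> same_pos_sign g h -> same_pos_sign f h.
Proof.
by move=> [e s] [e' s']; split; [move=> k k0; rewrite e // e'|rewrite s s'].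
Qed.

Lemma absf_flip0 f : absf (flip0 f) = absf f.
Proof. by apply/funext => -[|k]. Qed.

Section Reals.

Variable theta : nat -> nat.
Hypothesis theta_sys : system_function theta.

Implicit Types f g h : nat -> nat.

(** * Evaluation of initial segments *)

(** Horner scheme for P_N: the weight of digit n+1 times [theta n] is the weight of digit n. The
    value at 0 is not read, and [theta 0] only multiplies 0. *)
Fixpoint prefix_value N f : nat :=
  if N is N'.+1 then prefix_value N' f * theta N' + f N else 0.

Lemma prefix_value_eq N f g :
  (forall k, 0 < k -> k <= N -> f k = g k) -> prefix_value N f = prefix_value N g.
Proof.
elim: N => // N IH e /=; rewrite e // IH // => k k0 kN.
by apply: e => //; apply: leqW.
Qed.

(** For N > n, the unit gained at n is worth the [theta n] units lost at n+1. For N = n only the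
    gain is seen, and for N < n neither change is. *)
Lemma prefix_value_contraction N n f : applicable theta n f ->
  prefix_value N (contraction theta n f) = prefix_value N f + (N == n).
Proof.
move=> [n0 nf]; elim: N => [|N IH] /=; first by case: n n0 {nf}.
rewrite IH /contraction eqSS.
case: (eqVneq N n) => [->|Nn].
  have -> : (n.+1 == n) = false by lia.
  by rewrite mulnDl mul1n; lia.
by case: (eqVneq N.+1 n) => [<-|_]; rewrite !addn0 ?addnA.
Qed.

Lemma prefix_value_contract N s f : seq_applicable theta s f ->
  prefix_value N (contract theta s f) = prefix_value N f + count_mem N s.
Proof.
elim: s f => [|n s IH] f /=; first by rewrite addn0.
by move=> [na /IH ->]; rewrite prefix_value_contraction // eq_sym addnA.
Qed.

Definition reduced h := forall k, 2 <= k -> h k < theta (k - 1).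

(** An excess of [f] over [h] cannot be made up by later digits: one unit at M outweighs digit M+1
    of [h], which is less than [theta M]. *)
Lemma prefix_value_le_reduced f h N M : reduced h -> N <= M ->
  prefix_value M f <= prefix_value M h -> prefix_value N f <= prefix_value N h.
Proof.
move=> hr; elim: M => [|M IH]; first by rewrite leqn0 => /eqP ->.
rewrite leq_eqVlt => /orP[/eqP -> //|NM] /= le; apply: IH => //.
(* [reduced] bounds the digits only from index 2 on; for M = 0 both prefix values are 0. *)
case: M le {NM} => // M le.
have := hr M.+2 isT; rewrite subn1 [_.-1]/= => hlt.
move: le; rewrite -/(prefix_value M.+1 f) -/(prefix_value M.+1 h) => le.
rewrite leqNgt; apply/negP => lt.
have := leq_mul lt (leqnn (theta M.+1)); rewrite mulSn; lia.
Qed.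

Definition contracts_to f h := forall N, 0 < N ->
  exists2 s, seq_applicable theta s f &
    forall n, n <= N -> contract theta s f n = h n.

Lemma prefix_value_contracts_to f h s N : reduced h -> contracts_to f h ->
  seq_applicable theta s f ->
  prefix_value N (contract theta s f) <= prefix_value N h.
Proof.
move=> hr fh sa.
(* [M] exceeds N and every index in [s], so [s] leaves the prefix value at [M] unchanged. The
   comparison is made there and then brought down to N. *)
pose M := (N + \sum_(i <- s) i).+1.
have Ms : count_mem M s = 0.
  apply/count_memPn/negP => Mins.
  by move: (leq_addl N (\sum_(i <- s) i)); rewrite {1}(big_rem M) //= /M; lia.
apply: (@prefix_value_le_reduced _ _ _ M) => //; first by rewrite /M; lia.
rewrite prefix_value_contract // Ms addn0.
have [t ta tE] := fh M isT.
rewrite -(@prefix_value_eq M (contract theta t f) h) => [|k _ /tE //].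
by rewrite prefix_value_contract // leq_addr.
Qed.

Lemma contract_0 s f : seq_applicable theta s f -> contract theta s f 0 = f 0.
Proof.
by elim: s f => //= n s IH f [[n0 _] /IH ->]; rewrite /contraction; case: n n0.
Qed.

Lemma contracts_to_0 f h : contracts_to f h -> f 0 = h 0.
Proof. by case/(_ 1 isT) => s sa <- //; rewrite contract_0. Qed.

Lemma contracts_to_unique f h h' : reduced h -> reduced h' ->
  contracts_to f h -> contracts_to f h' -> h = h'.
Proof.
have le g g' N : reduced g -> contracts_to f g -> contracts_to f g' ->
    prefix_value N g' <= prefix_value N g.
  move=> gr fg /(_ N.+1 isT)[s sa sE].
  rewrite -(@prefix_value_eq N (contract theta s f) g') => [|k _ kN].
    exact: prefix_value_contracts_to.
  by apply: sE; apply: leqW.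
move=> hr hr' fh fh'.
have eqv N : prefix_value N h = prefix_value N h'.
  by apply/eqP; rewrite eqn_leq !le.
apply/funext => -[|k]; first by rewrite -(contracts_to_0 fh) (contracts_to_0 fh').
by have /= := eqv k.+1; rewrite eqv => /addnI.
Qed.

Lemma contracts_to_refl h : contracts_to h h.
Proof. by move=> N _; exists [::]. Qed.

(** * The base set *)

Lemma A_p_A_s_disjoint h : A_p theta h -> A_s theta h -> False.
Proof.
by move=> [_ hp] [_ [N N0 hs]]; have [M /hs] := hp N N0.
Qed.

Lemma is_Nmin_unique h N N' : is_Nmin theta h N -> is_Nmin theta h N' -> N = N'.
Proof.
move=> [N0 hN minN] [N'0 hN' minN']; apply/eqP.
by rewrite eqn_leq minN // minN'.
Qed.

(** The first component is the second with its tail of maximal digits carried, as 1.000... arises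
    from 0.999.... The place of the carry depends on the second component alone. *)
Lemma W1_primary_unique p q : W1 theta p -> W1 theta q -> p.2 = q.2 -> p.1 = q.1.
Proof.
move=> [_ _ [N Np [p_lt p_eq p_gt]]] [_ _ [N' Nq [q_lt q_eq q_gt]]] e.
rewrite -e in Nq q_lt q_eq; rewrite -(is_Nmin_unique Np Nq) in q_lt q_eq q_gt.
apply/funext => k; case: (ltngtP k N) => [kN|kN|->].
- by rewrite p_lt // q_lt.
- by rewrite p_gt // q_gt.
- by rewrite p_eq q_eq.
Qed.

Lemma base_reduced b h : base theta b -> b h -> reduced h.
Proof.
move=> [[C [p0 _ ->] <-] [p [[[p1 _] [p2 _] _] _] [] -> //]|].
by move=> [x _ ->] [[[hr _] _] _].
Qed.

Lemma base_nonempty b : base theta b -> b !=set0.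
Proof.
move=> [[C [p pW ->] <-]|[x xW ->]].
  by exists p.1; exists p; [split=> //; split|left].
by exists x; split=> //; split.
Qed.

Lemma W1_sign p : W1 theta p -> sign p.2 = sign p.1.
Proof. by move=> [_ _ [N [N0 _ _] [e _ _]]]; rewrite /sign e. Qed.

Lemma base_sign b h h' : base theta b -> b h -> b h' -> sign h = sign h'.
Proof.
have aux : forall C, base theta C -> exists e, forall g, C g -> sign g = e.
  move=> _ [[C [p pW ->] <-]|[x xW ->]].
    exists (sign p.1) => g [q [qW [_ ->]]] [] -> //.
    exact: W1_sign.
  by exists (sign x) => g [_ [_ ->]].
by move=> /aux[e eP] /eP -> /eP ->.
Qed.

Lemma classes_eq (T : Type) (W : set T) (R : T -> T -> Prop) (x y z : T) :
  (forall u v, R u v -> R v u) -> (forall u v w, R u v -> R v w -> R u w) ->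
  R x z -> R y z -> [set t | W t /\ R x t] = [set t | W t /\ R y t].
Proof.
move=> sy tr xz yz; have xy := tr _ _ _ xz (sy _ _ yz).
by apply/seteqP; split=> t [tW tR]; split=> //; apply: tr tR => //; apply: sy.
Qed.

Lemma W2_components b h : base_F theta b -> b h -> ~ W2 theta h.
Proof.
move=> [C [p0 _ ->] <-] [p [pW _] hp] [_]; apply.
by exists p.
Qed.

(** Members of F and of G_2 are separated by the definition of [W2]. Within each collection, a
    shared function yields a shared element of two equivalence classes. *)
Lemma base_disjoint b b' h :
  base theta b -> base theta b' -> b h -> b' h -> b = b'.
Proof.
move=> [Fb|Gb] [Fb'|Gb'] bh b'h.
- case: Fb bh => _ [p0 p0W ->] <- [p [pW p0p] hp].
  case: Fb' b'h => _ [q0 q0W ->] <- [q [qW q0q] hq].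
  have pq : p.1 = q.1.
    move: (pW) (qW) => [pp ps _] [qp qs _].
    (* No function is both primary and secondary, so [h] has the same role in [p] and in [q]. *)
    case: hp hq => -> [] e //; last exact: W1_primary_unique.
      by case: (@A_p_A_s_disjoint p.1) => //; rewrite e.
    by case: (@A_p_A_s_disjoint p.2) => //; rewrite e.
  congr components; rewrite -pq in q0q.
  apply: (@classes_eq _ _ (fun p q => same_pos_sign p.1 q.1) _ _ p) => //.
    by move=> u v; apply: same_pos_sign_sym.
  by move=> u v w; apply: same_pos_sign_trans.
- case: (W2_components Fb bh).
  by case: Gb' b'h => x _ -> [].
- case: (W2_components Fb' b'h).
  by case: Gb bh => x _ -> [].
- case: Gb bh => x _ -> [_ xh]; case: Gb' b'h => y _ -> [_ yh].
  apply: (@classes_eq _ _ same_pos_sign _ _ h) => //.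
    exact: same_pos_sign_sym.
  exact: same_pos_sign_trans.
Qed.

Lemma r_disjoint b b' f : base theta b -> base theta b' ->
  r_ theta b f -> r_ theta b' f -> b = b'.
Proof.
move=> bB b'B [h bh fh] [h' b'h' fh'].
have hh' : h = h'.
  by apply: contracts_to_unique fh fh'; [apply: base_reduced bh|
    apply: base_reduced b'h'].
by apply: base_disjoint bh _; rewrite // hh'.
Qed.

Lemma base_of_eq b h : base theta b -> b h -> base_of theta h = b.
Proof.
move=> bB bh; rewrite /base_of; case: (@getPex _ [set b | base theta b /\ b h]).
  by exists b.
by move=> cB ch; apply: base_disjoint ch bh.
Qed.

(** * Change of sign *)

Lemma A_p_eq_pos f g : eq_pos f g -> A_p theta f -> A_p theta g.
Proof.
move=> e [fr fp]; split=> [k k2|N N0]; first by rewrite -e ?fr //; lia.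
by have [M NM fM] := fp N N0; exists M; rewrite // -e //; lia.
Qed.

Lemma full_after_eq_pos f g N :
  eq_pos f g -> full_after theta f N -> full_after theta g N.
Proof. by move=> e fN M NM; rewrite -e ?fN //; lia. Qed.

Lemma A_s_eq_pos f g : eq_pos f g -> A_s theta f -> A_s theta g.
Proof.
move=> e [fr [N N0 fN]]; split=> [k k2|]; first by rewrite -e ?fr //; lia.
by exists N => //; apply: full_after_eq_pos fN.
Qed.

Lemma eq_pos_flip0 f : eq_pos f (flip0 f).
Proof. by move=> k k0; rewrite flip0_pos. Qed.

Lemma eq_pos_flip0r f : eq_pos (flip0 f) f.
Proof. by move=> k k0; rewrite flip0_pos. Qed.

Definition flip_pair (p : (nat -> nat) * (nat -> nat)) := (flip0 p.1, flip0 p.2).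

Lemma flip_pairK : involutive flip_pair.
Proof. by case=> f g; rewrite /flip_pair /= !flip0K. Qed.

Lemma W1_flip p : W1 theta p -> W1 theta (flip_pair p).
Proof.
move=> [pp ps [N [N0 fN minN] [p_lt p_eq p_gt]]]; split.
- exact: A_p_eq_pos (@eq_pos_flip0 _) pp.
- exact: A_s_eq_pos (@eq_pos_flip0 _) ps.
- exists N; split=> //=.
  + exact: full_after_eq_pos (@eq_pos_flip0 _) fN.
  + move=> N' N'0 /(full_after_eq_pos (@eq_pos_flip0r _)); exact: minN.
  (* Here [k] may be 0. [flip0] reads only the values at 0 and at [k], and both indices are below
     [N]. *)
  + by move=> k kN; rewrite /flip0 !p_lt.
  + by rewrite !flip0_pos.
  + by move=> k kN; rewrite flip0_pos ?p_gt //; lia.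
Qed.

Lemma components_flip (C : set ((nat -> nat) * (nat -> nat))) :
  flip0 @^-1` components C = components (flip_pair @^-1` C).
Proof.
apply/seteqP; split=> h /= [p Cp hp]; exists (flip_pair p).
- by rewrite /= flip_pairK.
- by case: hp => e; [left|right]; rewrite /= -e flip0K.
- by [].
- by case: hp => ->; [left|right].
Qed.

Lemma W2_flip h : W2 theta h -> W2 theta (flip0 h).
Proof.
move=> [hp hW1]; split; first exact: A_p_eq_pos (@eq_pos_flip0 _) hp.
move=> [p pW hE]; apply: hW1; exists (flip_pair p); first exact: W1_flip.
by case: hE => e; [left|right]; rewrite /= -e flip0K.
Qed.

(** Since the flip is an involution compatible with the equivalences, the preimage of the class of x
    is the class of the flipped x. *)
Lemma base_flip b : base theta b -> base theta (flip0 @^-1` b).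
Proof.
move=> [[_ [p pW ->] <-]|[x xW ->]]; [left|right].
  rewrite components_flip.
  eexists; last reflexivity.
  exists (flip_pair p); first exact: W1_flip.
  apply/seteqP; split=> q /= [qW pq]; split; try exact: W1_flip.
  - by rewrite -(flip_pairK q); apply: W1_flip.
  - by apply/same_pos_sign_flip0; rewrite flip0K.
  - by apply/same_pos_sign_flip0; rewrite flip0K.
exists (flip0 x); first exact: W2_flip.
apply/seteqP; split=> h /= [hW xh]; split; try exact: W2_flip.
- by rewrite -(flip0K h); apply: W2_flip.
- by apply/same_pos_sign_flip0; rewrite flip0K.
- by apply/same_pos_sign_flip0; rewrite flip0K.
Qed.

Lemma flip_preimageK (X : set (nat -> nat)) : flip0 @^-1` (flip0 @^-1` X) = X.
Proof. by apply/seteqP; split=> f; rewrite /preimage /= flip0K. Qed.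

Lemma contraction_flip n f : 0 < n ->
  contraction theta n (flip0 f) = flip0 (contraction theta n f).
Proof. by case: n => // n _; apply/funext => -[|k]. Qed.

Lemma seq_applicable_flip s f : seq_applicable theta s f ->
  seq_applicable theta s (flip0 f) /\
  contract theta s (flip0 f) = flip0 (contract theta s f).
Proof.
elim: s f => //= n s IH f [[n0 nf] /IH[sa sE]].
by rewrite contraction_flip.
Qed.

Lemma contracts_to_flip f h : contracts_to f h -> contracts_to (flip0 f) (flip0 h).
Proof.
move=> fh N N0; have [s sa sE] := fh N N0.
have [sa' sE'] := seq_applicable_flip sa; exists s => // n nN.
by rewrite sE' /flip0 !sE.
Qed.

Lemma r_flip b : r_ theta (flip0 @^-1` b) = flip0 @^-1` r_ theta b.
Proof.
apply/seteqP; split=> f [h bh fh].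
  by exists (flip0 h) => //; apply: contracts_to_flip.
exists (flip0 h); first by rewrite /= flip0K.
by rewrite -(flip0K f); apply: contracts_to_flip.
Qed.

(** * Real numbers *)

(** A first component of a pair in [W1] is positive at the carry position, and a second component
    ends in digits [theta] - 1, which are at least 1. This places the zero function in G_2, so that
    [b1] is an element of the base set. *)
Lemma W2_eq_pos_zero z : eq_pos z zero_fun -> W2 theta z.
Proof.
move=> z0; split.
  apply: (@A_p_eq_pos zero_fun) => [k /z0 //|]; split=> [k k2|N N0].
    by apply: (@leq_trans 2) => //; apply: theta_sys; lia.
  exists N.+1; first lia.
  by have := theta_sys N0; rewrite /zero_fun subSS subn0; lia.
move=> [p [pp ps [N [N0 _ _] [_ pN _]]] [] zE].
  by have := z0 N N0; rewrite zE pN /zero_fun addn1.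
have [_ [M M0 /(_ M.+1)]] := ps.
rewrite -zE z0 // addn1 leqnn subSS subn0 => /(_ isT).
by have := theta_sys M0; rewrite /zero_fun; lia.
Qed.

Lemma base_of_zero z : eq_pos z zero_fun ->
  base theta (base_of theta z) /\ base_of theta z z.
Proof.
move=> /W2_eq_pos_zero zW.
pose b := [set y | W2 theta y /\ same_pos_sign z y].
have bB : base theta b by right; exists z.
have bz : b z by split=> //; split.
by rewrite (base_of_eq bB bz).
Qed.

Lemma base_b1 : base theta (b1 theta). Proof. by have [] := @base_of_zero zero_fun. Qed.

Lemma b1_zero : b1 theta zero_fun. Proof. by have [] := @base_of_zero zero_fun. Qed.

Lemma flip0_neg_zero : flip0 neg_zero_fun = zero_fun.
Proof. by apply/funext => -[|k]. Qed.

Lemma flip_b1 : flip0 @^-1` b1 theta = b2 theta.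
Proof.
rewrite /b2 (@base_of_eq (flip0 @^-1` b1 theta)) //; first exact: base_flip base_b1.
by rewrite /= flip0_neg_zero; apply: b1_zero.
Qed.

Lemma flip_b2 : flip0 @^-1` b2 theta = b1 theta.
Proof. by rewrite -flip_b1 flip_preimageK. Qed.

Lemma base_b2 : base theta (b2 theta).
Proof. by rewrite -flip_b1; apply: base_flip base_b1. Qed.

Lemma rzero_zero : rzero theta zero_fun.
Proof.
by left; exists zero_fun; [apply: b1_zero|apply: contracts_to_refl].
Qed.

Lemma reals_rzero : reals theta (rzero theta). Proof. by right. Qed.

(** The flip exchanges [b1] and [b2], hence the two halves of the union. *)
Lemma flip_rzero : flip0 @^-1` rzero theta = rzero theta.
Proof.
by rewrite /rzero preimage_setU -!r_flip flip_b1 flip_b2 setUC.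
Qed.

Lemma reals_flip X : reals theta X -> reals theta (flip0 @^-1` X).
Proof.
move=> [[b [bB b12] <-]|->]; last by rewrite flip_rzero; right.
left; exists (flip0 @^-1` b); last exact: r_flip.
split; first exact: base_flip.
case=> e; apply: b12; [right|left].
  by rewrite -flip_b1 -e flip_preimageK.
by rewrite -flip_b2 -e flip_preimageK.
Qed.

Lemma rzero_r_disjoint b f : base theta b -> ~ [set b1 theta; b2 theta] b ->
  rzero theta f -> r_ theta b f -> False.
Proof.
move=> bB b12 [] f0 bf; apply: b12.
  by left; apply: r_disjoint bf f0; rewrite //; apply: base_b1.
by right; apply: r_disjoint bf f0; rewrite //; apply: base_b2.
Qed.

Lemma reals_disjoint X Y f : reals theta X -> reals theta Y -> X f -> Y f -> X = Y.
Proof.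
move=> [[b [bB b12] <-]|->] [[c [cB c12] <-]|->] // Xf Yf.
- by rewrite (r_disjoint bB cB Xf Yf).
- by case: (rzero_r_disjoint bB b12 Yf Xf).
- by case: (rzero_r_disjoint cB c12 Xf Yf).
Qed.

Lemma class_of_eq X f : reals theta X -> X f -> class_of theta f = X.
Proof.
move=> XR Xf; rewrite /class_of.
case: (@getPex _ [set X | reals theta X /\ X f]); first by exists X.
by move=> YR Yf; apply: reals_disjoint Yf Xf.
Qed.

Lemma reals_nonempty X : reals theta X -> X !=set0.
Proof.
move=> [[b [bB _] <-]|->]; last by exists zero_fun; apply: rzero_zero.
by have [h bh] := base_nonempty bB; exists h; exists h => //; apply: contracts_to_refl.
Qed.

Lemma reals_sign X f g : reals theta X -> X <> rzero theta ->
  X f -> X g -> sign f = sign g.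
Proof.
move=> [[b [bB _] <-]|-> //] _ [h bh fh] [h' bh' gh'].
by rewrite /sign (contracts_to_0 fh) (contracts_to_0 gh') -!/(sign _)
  (base_sign bB bh bh').
Qed.

(** Both sides apply [get] to the same set of candidates, so they agree whether or not a candidate
    exists. *)
Lemma rabs_flip X : rabs theta (flip0 @^-1` X) = rabs theta X.
Proof.
congr get; apply/seteqP; split=> Z [ZR XZ]; split=> // f Xf.
  by rewrite -absf_flip0; apply: XZ; rewrite /= flip0K.
by rewrite -absf_flip0; apply: XZ.
Qed.

Lemma subsum_flip X f g : reals theta X -> X f -> X (flip0 g) ->
  subsum theta f g = zero_fun.
Proof.
(* The branch of equal signs is impossible: outside [0], [f] and [flip0 g] have the same sign, so
   [f] and [g] do not. *)
move=> XR Xf Xg; rewrite /subsum; case: asboolP => [[fg f0 g0]|_].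
  have X0 : X <> rzero theta by move=> e; apply: f0; rewrite -e.
  by case: (@sign_flip0_neq g); rewrite -fg; apply: (reals_sign XR).
case: asboolP => // -[].
by rewrite (class_of_eq XR Xf) (class_of_eq (reals_flip XR) Xg) rabs_flip.
Qed.

Lemma radd_flip X : reals theta X -> radd theta X (flip0 @^-1` X) = rzero theta.
Proof.
move=> XR; rewrite /radd.
case: (@getPex _ [set Z | reals theta Z /\ forall f g, X f ->
    (flip0 @^-1` X) g -> Z (subsum theta f g)]).
  exists (rzero theta); split; first exact: reals_rzero.
  by move=> f g Xf Xg; rewrite (subsum_flip XR Xf Xg); apply: rzero_zero.
(* A representative is needed to know that the set chosen by [get] contains [zero_fun]; disjointness
   then identifies it with [rzero]. *)
move=> ZR XZ; have [f Xf] := reals_nonempty XR.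
have Xff : X (flip0 (flip0 f)) by rewrite flip0K.
have := XZ f (flip0 f) Xf Xff; rewrite (subsum_flip XR Xf Xff) => Z0.
exact: reals_disjoint reals_rzero Z0 rzero_zero.
Qed.

End Reals.

Theorem mainTheorem8 (theta : nat -> nat) (theta_sys : system_function theta)
    (F : set (nat -> nat)) (F_real : reals theta F) :
  exists2 G : set (nat -> nat), reals theta G & radd theta F G = rzero theta.
Proof.
exists (flip0 @^-1` F); first exact: reals_flip.
exact: radd_flip.
Qed.
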